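(* Let $\alpha,\beta\in CBV^*[0,1]$ and $v,w\in CBV[0,1]$ satisfy: $\alpha[e]=\beta[e]=0$ where $e\equiv1$; $|\alpha[v]-\beta[v]|<1$; and $v(t)+w(t)=1$ for all $t\in[0,1]$. Let $p\in(1,+\infty]$, $q\in[1,+\infty)$ with $p^{-1}+q^{-1}=1$. Let $f\colon[0,1]\times\mathbb R\to\mathbb R$ satisfy: $t\mapsto f(t,u)$ is Lebesgue measurable for every $u$; $u\mapsto f(t,u)$ is continuous for a.e. $t$; there exist a non-decreasing $\psi\colon[0,+\infty)\to[0,+\infty)$ and $\phi\in L^p([0,1])$, $\phi\ge0$, with $|f(t,u)|\le\phi(t)\psi(|u|)$ for all $t\in[0,1]$, $u\in\mathbb R$; and $\lim_{r\to+\infty}\psi(r)/r=0$. Let $k\colon[0,1]^2\to\mathbb R$ satisfy: $s\mapsto k(t,s)$ is in $L^q([0,1])$ for every $t$; there is $m\in L^q([0,1])$, $m\ge0$, with $\operatorname{var}_{[0,1]}k(\cdot,s)\le m(s)$ for a.e. $s$; and $\lim_{t\to\tau}\int_0^1|k(t,s)-k(\tau,s)|\phi(s)\,ds=0$ for every $\tau\in[0,1]$. Then the equation $x(t)=\alpha[x]v(t)+\beta[x]w(t)+\int_0^1k(t,s)f(s,x(s))\,ds$, $t\in[0,1]$, has a solution $x\in CBV[0,1]$.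
   Context: $BV[0,1]$ is the Banach space of real functions of bounded Jordan variation on $[0,1]$ with norm $\|f\|_{BV}=|f(0)|+\operatorname{var}_{[0,1]}f$; $CBV[0,1]$ is its closed subspace of continuous functions, and $CBV^*[0,1]$ its dual (continuous linear functionals). *)

(* Defs.v *)
From mathcomp Require Import all_boot all_order all_algebra.
From mathcomp Require Import all_classical all_reals all_analysis.
Import Order.TTheory GRing.Theory Num.Theory.
Import numFieldNormedType.Exports.
Set Implicit Arguments. Unset Strict Implicit. Unset Printing Implicit Defensive.
Local Open Scope classical_set_scope.
Local Open Scope ring_scope.

Section defs.
Context {R : realType}.

(** The real line equipped with the (completed) Lebesgue sigma-algebra;
    it is definitionally R. *)
Definition LebR : Type :=
  ltac:(let t := type of (@completed_lebesgue_measure R) in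
        match t with set ?X -> _ => exact X end).

(** Lebesgue measure (completed, so that "Lebesgue measurable" is meant). *)
Definition leb : {measure set LebR -> \bar R} := @completed_lebesgue_measure R.

Definition I01 : set LebR := `[0, 1]%classic.

Definition leb_meas01 (g : R -> R) : Prop := measurable_fun I01 (g : LebR -> R).

Definition in_Lp01 (p : \bar R) (g : R -> R) : Prop :=
  leb_meas01 g /\
  match p with
  | r%:E => (\int[leb]_(x in I01) (`|g x| `^ r)%:E < +oo)%E
  | +oo%E => exists M : R, {ae leb, forall x : LebR, I01 x -> `|g x| <= M}
  | -oo%E => False
  end.

Definition CBV (x : R -> R) : Prop :=
  {within `[0, 1]%classic, continuous x} /\ bounded_variation 0 1 x.

Definition BVnorm (x : R -> R) : R := `|x 0| + fine (total_variation 0 1 x).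

Definition CBVdual (a : (R -> R) -> R) : Prop :=
  (forall (c : R) (x y : R -> R), CBV x -> CBV y ->
     a (fun t => c * x t + y t) = c * a x + a y) /\
  (exists C : R, forall x, CBV x -> `|a x| <= C * BVnorm x).

End defs.

(* Main.v *)
Require Import Defs.
From mathcomp Require Import all_boot all_order all_algebra.
Set Implicit Arguments. Unset Strict Implicit. Unset Printing Implicit Defensive.

(** Eliminating alpha[x] and beta[x] turns the equation into x = L (K x), where
    K x (t) = int k(t,s) f(s,x(s)) ds and L, bounded on CBV, solves the linear
    boundary problem; as v + w = 1 and alpha, beta vanish on constants, the latter is
    solvable because 1 - (alpha[v] - beta[v]) is nonzero.  As psi is sublinear, f may
    be truncated outside some [-r,r] that is preserved by L K, so that
    |f| <= h := psi(r) phi.  The variation of K x - K y is at most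
    int m |f(s,x(s)) - f(s,y(s))| ds, so pointwise convergence of bounded arguments
    gives BV-norm convergence of the images by dominated convergence, although
    alpha and beta are only BV-continuous.  For each n, Brouwer's theorem gives a
    step function that agrees with its image under L K at the points of a grid of
    mesh 1/(n+1).  These images are pointwise equicontinuous, so a diagonal
    subsequence of them converges pointwise, together with the step functions, to a
    fixed point.  Brouwer's theorem is derived from Scarf's combinatorial lemma, which needs no
    triangulation. *)

(** * Scarf's lemma *)

Section scarf.
Variables (T I : finType) (g : I -> T -> nat) (c : T -> I) (i0 : I) (t0 : T).
Hypothesis g_inj : forall i, injective (g i).
Implicit Types (s t : {set T}) (C D : {set I}).

(** Scarf's notion, with [g i] read as a linear order on [T]: no [y] lies strictly above the minimum
    of [s] in all the orders [i] of [C] at once. *)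
Definition dominant s C : bool :=
  [forall y, [exists i in C, [forall x in s, g i y <= g i x]]].

Lemma dominantP s C :
  reflect (forall y, exists2 i, i \in C & {in s, forall x, g i y <= g i x})
    (dominant s C).
Proof.
apply: (iffP forallP) => [h y|h y].
  have /existsP[i /andP[iC /forallP hi]] := h y.
  by exists i => // x xs; have := hi x; rewrite xs.
have [i iC hi] := h y; apply/existsP; exists i; rewrite iC /=.
by apply/forallP => x; apply/implyP => /hi.
Qed.

Lemma dominantS s t C D :
  t \subset s -> C \subset D -> dominant s C -> dominant t D.
Proof.
move=> /subsetP ts /subsetP CD /dominantP h; apply/dominantP => y.
by have [i /CD iD hi] := h y; exists i => // x /ts /hi.
Qed.

(** * Rooms, doors and their incidence *)

Let cell := ({set T} * {set I})%type.

Definition incident (d r : cell) : bool :=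
  (r.1 == d.1) && [exists j in d.2, r.2 == d.2 :\ j] ||
  (r.2 == d.2) && [exists x in r.1, d.1 == r.1 :\ x].

Lemma incidentP (d r : cell) :
  reflect ((exists2 j, j \in d.2 & r = (d.1, d.2 :\ j)) \/
           (exists2 x, x \in r.1 & d = (r.1 :\ x, r.2))) (incident d r).
Proof.
case: d r => [t D] [s C]; rewrite /incident /=.
apply: (iffP orP) => [[/andP[/eqP-> /existsP[j /andP[jD /eqP->]]]|
    /andP[/eqP-> /existsP[x /andP[xs /eqP->]]]]|[[j jD [-> ->]]|[x xs [-> ->]]]].
- by left; exists j.
- by right; exists x.
- by left; rewrite eqxx; apply/existsP; exists j; rewrite jD eqxx.
- by right; rewrite eqxx; apply/existsP; exists x; rewrite xs eqxx.
Qed.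

(** These play the part of the almost fully coloured faces in the proof of Sperner's lemma, with
    [i0] as the colour left out. *)
Definition door (d : cell) : bool :=
  [&& dominant d.1 d.2, #|d.2| == #|d.1|.+1, i0 \in d.2 & c @: d.1 == d.2 :\ i0].

Section internal_door.
Variables (t : {set T}) (D : {set I}) (x0 : T).
Hypotheses (x0t : x0 \in t) (domD : dominant t D) (cardD : #|D| = #|t|.+1).

Let m i := [arg min_(x < x0 in t) g i x].

Let mt i : m i \in t. Proof. by rewrite /m; case: arg_minnP. Qed.

Let m_min i x : x \in t -> g i (m i) <= g i x.
Proof. by rewrite /m; case: arg_minnP => // y yt hy /hy. Qed.

Let m_eq i x : x \in t -> {in t, forall z, g i x <= g i z} -> x = m i.
Proof.
by move=> xt h; apply: (@g_inj i); apply/eqP; rewrite eqn_leq m_min// h.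
Qed.

Let m_surj C : dominant t C -> t \subset m @: C.
Proof.
move=> /dominantP h; apply/subsetP => x xt.
have [i iC hi] := h x; apply/imsetP; exists i => //.
exact: m_eq.
Qed.

(* [assoc j] describes the rooms obtained by letting the index [j] lose its minimiser. *)
Let assoc j (r : cell) : Prop := dominant r.1 r.2 /\
  (r = (t, D :\ j) \/ exists x, [/\ x \notin t, r = (x |: t, D) &
    {in D :\ j, forall i, g i (m i) < g i x}]).

(** [M] collects the points above the minimum of [t] in every order of [D] but [j]. If it is empty,
    dropping [j] preserves dominance. Otherwise only the order [j] keeps [M] below [t], and the one
    possible new point is the [j]-largest element of [M]. *)
Let assoc_ex j : j \in D -> t \subset m @: (D :\ j) ->
  exists r, forall r', assoc j r' <-> r' = r.
Proof.
move=> jD /subsetP sub.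
pose M := [set y | [forall i in D :\ j, g i (m i) < g i y]].
have MP y : reflect {in D :\ j, forall i, g i (m i) < g i y} (y \in M).
  by rewrite inE; apply: (iffP forall_inP).
have notM y : y \notin M -> exists2 i, i \in D :\ j & g i y <= g i (m i).
  by rewrite inE => /forall_inPn[i iD]; rewrite -leqNgt => h; exists i.
have [M0|[y0 y0M]] := set_0Vmem M.
  have dj : dominant t (D :\ j).
    apply/dominantP => y; have [|i iD h] := notM y; first by rewrite M0 inE.
    by exists i => // x /(m_min i); apply: leq_trans.
  exists (t, D :\ j) => r; split=> [[_ [//|[x [_ _ /MP]]]]|->].
    by rewrite M0 inE.
  by split => //; left.
have [x xM xmax] := @arg_maxnP _ y0 (mem M) (g j) y0M.
have Mt z : z \in M -> z \notin t.
  move=> /MP zM; apply/negP => /sub /imsetP[i iD zE].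
  by have := zM i iD; rewrite zE ltnn.
have Mj z : z \in M -> {in t, forall y, g j z <= g j y}.
  move=> /MP zM; have [k kD hk] := dominantP _ _ domD z.
  suff <- : k = j by [].
  apply/eqP; apply: contraT => kj.
  by have := zM k; rewrite !inE kj kD ltnNge hk// => /(_ isT).
have dx : dominant (x |: t) D.
  apply/dominantP => y; have [yM|/notM[i iD yi]] := boolP (y \in M).
    exists j => // z /setU1P[->|]; [exact: xmax|exact: Mj].
  exists i; first by move: iD; rewrite inE => /andP[].
  move=> z /setU1P[->|zt]; last by rewrite (leq_trans yi)// m_min.
  by apply: leq_trans yi (ltnW _); move/MP: xM; apply.
exists (x |: t, D) => r; split=> [|->]; last first.
  by split => //; right; exists x; split => //; [exact: Mt|exact/MP].
case=> dr [rE|[x' [x't rE /MP x'M]]]; rewrite {r}rE /= in dr *.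
  have [i iD hi] := dominantP _ _ dr x; move/MP: xM => /(_ i iD).
  by rewrite ltnNge hi.
suff -> : x' = x by [].
have [i iD hi] := dominantP _ _ dr x.
have ij : i = j.
  apply/eqP; apply: contraT => ij; move/MP: xM => /(_ i).
  by rewrite !inE ij iD ltnNge hi ?inE ?mt ?orbT// => /(_ isT).
apply: (@g_inj j); apply/eqP; rewrite eqn_leq; apply/andP; split; first exact: xmax.
by rewrite -ij hi// !inE eqxx.
Qed.

(** By dominance [m] maps [D] onto [t], and [D] has one element more, so exactly one pair [a], [b]
    collides. Only these two indices can be released with [m] still onto, and each release yields
    one room. *)
Lemma internal_door_rooms :
  #|[set r : cell | dominant r.1 r.2 && incident (t, D) r]| = 2.
Proof.
have subm C : m @: C \subset t by apply/subsetP => _ /imsetP[i _ ->].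
have /dinjectivePn[a aD [b]] : ~~ dinjectiveb m (mem D).
  apply/negP => /dinjectiveP /card_in_imset h.
  by have := subset_leq_card (subm D); rewrite h cardD ltnn.
rewrite !inE => /andP[ba bD] mab.
have mD : m @: D = t by apply/eqP; rewrite eqEsubset subm m_surj.
have mDa : t \subset m @: (D :\ a).
  rewrite -{1}mD; apply/subsetP => _ /imsetP[i iD ->].
  have [->|ia] := eqVneq i a; first by rewrite mab imset_f// !inE ba.
  by rewrite imset_f// !inE ia.
have mDb : t \subset m @: (D :\ b).
  rewrite -{1}mD; apply/subsetP => _ /imsetP[i iD ->].
  have [->|ib] := eqVneq i b; first by rewrite -mab imset_f// !inE eq_sym ba.
  by rewrite imset_f// !inE ib.
have cardDj j : j \in D -> #|D :\ j| = #|t|.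
  by move=> jD; have := cardsD1 j D; rewrite jD cardD => -[].
have collide j : j \in D -> t \subset m @: (D :\ j) -> j = a \/ j = b.
  move=> jD sub; have /eqP/imset_injP inj : #|m @: (D :\ j)| = #|D :\ j|.
    by rewrite cardDj//; apply/eqP; rewrite eqn_leq !subset_leq_card.
  have [->|ja] := eqVneq j a; first by left.
  have [->|jb] := eqVneq j b; first by right.
  have := inj a b; rewrite !inE (eq_sym a) (eq_sym b) ja jb aD bD.
  by move=> /(_ isT isT mab) ab; rewrite ab eqxx in ba.
have [ra raP] := assoc_ex aD mDa; have [rb rbP] := assoc_ex bD mDb.
have incE (r : cell) : dominant r.1 r.2 && incident (t, D) r <-> assoc a r \/ assoc b r.
  split=> [/andP[dr /incidentP[[j jD rE]|[x xr tE]]]|].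
  - have [||<-|<-] := collide j => //; first by apply: m_surj; rewrite rE in dr.
      by left; split => //; left.
    by right; split => //; left.
  - have xt : x \notin t by case: tE => -> _; rewrite !inE eqxx.
    have rE : r = (x |: t, D).
      by case: r {dr} xr tE => s C /= xs [-> ->]; rewrite setD1K.
    rewrite {r xr tE}rE /= in dr *.
    have [j jD hj] := dominantP _ _ dr x.
    (* These indices keep their minimiser when [x] arrives. Dominance of the new room makes them map
       onto [t], so [D'] misses only [j]. *)
    pose D' := [set i in D | g i (m i) < g i x].
    have D'j : D' \subset D :\ j.
      apply/subsetP => i; rewrite !inE => /andP[-> h]; rewrite andbT.
      by apply: contraTneq h => ->; rewrite -leqNgt hj// !inE mt orbT.
    have tD' : t \subset m @: D'.
      apply/subsetP => z zt; have [i iD hi] := dominantP _ _ dr z.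
      have zE : z = m i by apply: m_eq => // y yt; rewrite hi// !inE yt orbT.
      rewrite zE imset_f// inE iD/= ltn_neqAle -zE hi ?inE ?eqxx// andbT.
      by apply: contraNneq xt => /g_inj <-.
    have D'E : D' = D :\ j.
      apply/eqP; rewrite eqEcard D'j cardDj//.
      by apply: leq_trans (leq_imset_card m _); exact: subset_leq_card.
    have aj : assoc j (x |: t, D).
      split => //; right; exists x; split => // i.
      by rewrite -D'E inE => /andP[].
    rewrite D'E in tD'.
    by have [||<-|<-] := collide j => //; [left|right].
  - have done_ j : j \in D -> assoc j r -> dominant r.1 r.2 && incident (t, D) r.
      move=> jD [dr [rE|[x [xt rE _]]]]; rewrite dr; apply/incidentP.
        by left; exists j.
      right; exists x; first by rewrite rE !inE eqxx.
      by rewrite rE /= setU1K.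
    by case=> /done_; apply.
(* The delicate case is a common new point: as [a] and [b] differ, it would exceed the minimum of
   [t] in every order of [D], against [domD]. *)
have rab : ra != rb.
  apply/eqP => E; have [dr ha] := (raP ra).2 erefl; have [_ hb] := (rbP ra).2 E.
  have DE : D :\ a <> D :\ b.
    by move/setP/(_ a); rewrite !inE eqxx aD eq_sym ba.
  case: ha hb => [->|[x [xt -> hx]]] [|[x' [x't]]].
  - by case.
  - by case=> /setP/(_ x'); rewrite !inE eqxx (negPf x't).
  - by case=> /setP/(_ x); rewrite !inE eqxx (negPf xt).
  case=> /setP/(_ x) xx' hx'.
  have /eqP xE : x == x' by move: xx'; rewrite !inE eqxx (negPf xt) !orbF => <-.
  rewrite -xE in hx'.
  have [i iD hi] := dominantP _ _ domD x.
  have [ia|ia] := eqVneq i a.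
    rewrite ia in hi.
    by have := hx' a; rewrite !inE (eq_sym a) ba aD ltnNge hi// => /(_ isT).
  by have := hx i; rewrite !inE iD ia ltnNge hi// => /(_ isT).
rewrite (_ : [set r | _] = [set ra; rb]) ?cards2 ?rab//.
apply/setP => r; rewrite !inE; apply/idP/orP.
  by move=> /incE[/raP->|/rbP->]; [left|right].
by case=> /eqP E; apply/incE; [left; apply/raP|right; apply/rbP].
Qed.
End internal_door.

(** The point added to the empty set must be the maximum of the order [i0]; dropping [i0] instead
    would leave no index to dominate with. *)
Lemma empty_door_rooms :
  #|[set r : cell | dominant r.1 r.2 && incident (set0, [set i0]) r]| = 1.
Proof.
have [x _ xmax] := @arg_maxnP _ t0 predT (g i0) isT.
rewrite (_ : [set r | _] = [set ([set x], [set i0])]) ?cards1//.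
apply/setP => -[s C]; rewrite !inE; apply/andP/eqP => [[/= dr]|[-> ->]].
  case/incidentP => [[j]|[y ys [s0 CE]]] /=.
    rewrite inE => /eqP-> [_ CE]; have [i] := dominantP _ _ dr x.
    by rewrite CE !inE andNb.
  have sE : s = [set y] by rewrite -(setD1K (ys : y \in s)) -s0 setU0.
  rewrite sE -{}CE in dr *; have [i] := dominantP _ _ dr x.
  rewrite inE => /eqP-> /(_ y); rewrite inE eqxx => /(_ isT) xy.
  congr ([set _], _); apply: (@g_inj i0); apply/eqP.
  by rewrite eqn_leq xy andbT; exact: xmax.
split=> /=.
  apply/dominantP => y; exists i0; first exact: set11.
  by move=> z /set1P ->; exact: xmax.
by apply/incidentP; right; exists x; rewrite ?set11//= setDv.
Qed.

(** A room with a door has two. If a colour [j] outside [C] occurs, the colours are distinct, and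
    the doors arise by adding the index [j] or removing the point coloured [j]. Otherwise the
    colours are [C] without [i0], one of them is used twice, and either of its points can be
    removed. *)
Lemma colorless_room_doors (r : cell) : c @: r.1 != r.2 ->
  dominant r.1 r.2 ->
  ~~ odd #|[set d : cell | door d && incident d r]|.
Proof.
case: r => s C /= cs dr.
set A := [set d | _].
have A1 j : j \notin C -> #|C| = #|s| -> i0 \in C -> c @: s = (j |: C) :\ i0 ->
    (s, j |: C) \in A.
  move=> jC cC i0C cE; rewrite inE; apply/andP; split.
    apply/and4P; split => /=; rewrite ?cE//; last by rewrite inE i0C orbT.
      by apply: dominantS dr => //; exact: subsetUr.
    by rewrite cardsU1 jC cC add1n.
  by apply/incidentP; left; exists j; rewrite ?setU11//= setU1K.
have A2 x : x \in s -> #|C| = #|s| -> i0 \in C -> c @: (s :\ x) = C :\ i0 ->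
    (s :\ x, C) \in A.
  move=> xs cC i0C cE; rewrite inE; apply/andP; split.
    apply/and4P; split => /=; rewrite ?cE//.
      by apply: dominantS dr => //; exact: subD1set.
    by rewrite cC (cardsD1 x s) xs add1n.
  by apply/incidentP; right; exists x.
have AE d : d \in A -> [/\ #|C| = #|s|, i0 \in C &
    (exists j, [/\ j \notin C, d = (s, j |: C) & c @: s = (j |: C) :\ i0]) \/
    (exists x, [/\ x \in s, d = (s :\ x, C) & c @: (s :\ x) = C :\ i0])].
  case: d => [t D]; rewrite inE => /andP[/and4P[/= _ /eqP cD i0D /eqP ct]].
  case/incidentP => [[j /= jD [sE CE]]|[x /= xs [tE DE]]].
    have jC : j \notin C by rewrite CE !inE eqxx.
    have DE : D = j |: C by rewrite CE setD1K.
    subst t D; have ji0 : i0 != j.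
      by apply: contraNneq cs => ij; rewrite ct ij setU1K.
    split; first by move: cD; rewrite cardsU1 jC => -[].
      by move: i0D; rewrite !inE (negPf ji0).
    by left; exists j.
  subst t D; split => //; first by rewrite cD (cardsD1 x s) xs.
  by right; exists x.
have type1 j : j \notin C -> #|C| = #|s| -> i0 \in C ->
    c @: s = (j |: C) :\ i0 -> #|A| = 2.
  move=> jC cC i0C cE.
  have ji0 : j != i0 by apply: contraNneq jC => ->.
  have /eqP/imset_injP inj : #|c @: s| = #|s|.
    rewrite cE -cC; apply/eqP; rewrite -eqSS -add1n.
    have := cardsD1 i0 (j |: C); rewrite !inE i0C orbT cardsU1 jC => <-.
    by rewrite add1n.
  have : j \in c @: s by rewrite cE !inE ji0 eqxx.
  case/imsetP => x xs jE.
  have cx : c @: (s :\ x) = C :\ i0.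
    apply/setP => k; rewrite !inE; apply/imsetP/andP => [[y]|[ki0 kC]].
      rewrite !inE => /andP[yx ys] ->; have : c y \in c @: s by rewrite imset_f.
      rewrite cE !inE => /andP[-> /orP[/eqP cyj|//]].
      by case/eqP: yx; apply: inj => //; rewrite cyj.
    have : k \in c @: s by rewrite cE !inE ki0 kC orbT.
    case/imsetP => y ys kE; exists y => //; rewrite !inE ys andbT.
    by apply: contraNneq jC => yx; rewrite jE -yx -kE.
  rewrite (_ : A = [set (s, j |: C); (s :\ x, C)]).
    rewrite cards2 (_ : _ != _)//; apply/eqP => -[sE _].
    by move: xs; rewrite sE !inE eqxx.
  apply/setP => d; rewrite !in_set2; apply/idP/orP.
    case/AE => _ _ [[j' [j'C -> cE']]|[x' [x's -> cx']]].
      left; have : j \in (j' |: C) :\ i0 by rewrite -cE' cE !inE eqxx ji0.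
      by rewrite !inE (negPf jC) orbF => /andP[_ /eqP->].
    right; have [->//|xx'] := eqVneq x x'.
    have : j \in c @: (s :\ x') by rewrite jE imset_f// !inE xx'.
    by rewrite cx' !inE (negPf jC) andbF.
  by case=> /eqP->; [exact: A1|exact: A2].
have [->|[d dA]] := set_0Vmem A; first by rewrite cards0.
suff -> : #|A| = 2 by [].
have [cC i0C [[j [jC _ cE]]|[x [xs _ cx]]]] := AE _ dA; first exact: (type1 j).
have csE : c @: s = c x |: (C :\ i0) by rewrite -{1}(setD1K xs) imsetU1 cx.
have cxi0 : c x != i0.
  by apply: contraNneq cs => cxi; rewrite csE cxi setD1K.
have [cxC|cxC] := boolP (c x \in C); last first.
  apply: (type1 (c x)) => //; rewrite csE; apply/setP => k; rewrite !inE.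
  by have [->|] := eqVneq k (c x); rewrite ?cxi0.
have : c x \in c @: (s :\ x) by rewrite cx !inE cxi0.
case/imsetP => x'; rewrite !inE => /andP[x'x x's] cxx'.
have csC : c @: s = C :\ i0.
  by rewrite csE; apply/setUidPr; rewrite sub1set !inE cxi0.
have /eqP/imset_injP inj : #|c @: (s :\ x)| = #|s :\ x|.
  rewrite cx; have := cardsD1 i0 C; have := cardsD1 x s.
  by rewrite xs i0C cC => -> [].
have cx' : c @: (s :\ x') = C :\ i0.
  rewrite -csC; apply/eqP; rewrite eqEsubset imsetS ?subD1set//=.
  apply/subsetP => _ /imsetP[y ys ->].
  have [->|yx'] := eqVneq y x'; last by rewrite imset_f// !inE yx'.
  by rewrite -cxx' imset_f// !inE eq_sym x'x.
rewrite (_ : A = [set (s :\ x, C); (s :\ x', C)]).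
  rewrite cards2 (_ : _ != _)//; apply/eqP => -[/setP/(_ x)].
  by rewrite !inE eqxx xs eq_sym x'x.
apply/setP => e; rewrite !in_set2; apply/idP/orP; last first.
  by case=> /eqP->; exact: A2.
case/AE => _ _ [[j [jC _ cE]]|[z [zs -> cz]]].
  have : j \in C :\ i0.
    by rewrite -csC cE !inE eqxx andbT; apply: contraNneq jC => ->.
  by rewrite !inE (negPf jC) andbF.
have [->|zx] := eqVneq z x; first by left.
have [->|zx'] := eqVneq z x'; first by right.
have : c z \in c @: (s :\ z) by rewrite cz -csC imset_f.
case/imsetP => y; rewrite !inE => /andP[yz ys] czy.
have [yx|yx] := eqVneq y x.
  case/eqP: zx'; apply: inj; rewrite ?inE ?zx ?x'x//.
  by rewrite czy yx.
by case/eqP: yz; apply: inj; rewrite ?inE ?zx ?yx.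
Qed.

(* Parity count of incident pairs: the door [(set0, [set i0])] lies in one room, every other
   door in two, and a room that is not colorful has an even number of doors. *)
Theorem scarf : exists s C, [/\ dominant s C & c @: s = C].
Proof.
suff : exists r : cell, dominant r.1 r.2 && (c @: r.1 == r.2).
  by move=> [[s C] /= /andP[dr /eqP cs]]; exists s, C.
apply/existsP; apply: contraT => /existsPn h.
have count : \sum_(d | door d) #|[set r : cell | dominant r.1 r.2 && incident d r]|
    = \sum_(r : cell | dominant r.1 r.2) #|[set d : cell | door d && incident d r]|.
  under eq_bigr do rewrite -sum1_card.
  under [RHS]eq_bigr do rewrite -sum1_card.
  rewrite (exchange_big_dep (fun r : cell => dominant r.1 r.2))/=; last first.
    by move=> d r _; rewrite inE => /andP[].
  apply: eq_bigr => r dr; apply: eq_bigl => d.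
  by rewrite !inE dr.
have : odd (\sum_(d | door d) #|[set r : cell | dominant r.1 r.2 && incident d r]|).
  have d0 : door (set0, [set i0]).
    apply/and4P; split => /=; rewrite ?cards1 ?cards0 ?set11//.
      apply/dominantP => y; exists i0; first exact: set11.
      by move=> z; rewrite inE.
    by rewrite imset0 setDv.
  rewrite (bigD1 _ d0)/= empty_door_rooms oddD/= (_ : odd _ = false)//.
  apply/negbTE; elim/big_ind: _ => //= [x y /negbTE ox /negbTE oy|[t D] /andP[]].
    by rewrite oddD ox oy.
  case/and4P => /= dt /eqP cardD i0D /eqP ct tD.
  have [t0E|[x xt]] := set_0Vmem t; last by rewrite (internal_door_rooms xt).
  move: cardD ct tD; rewrite t0E cards0 => /eqP/cards1P[i ->].
  rewrite imset0 => /setP/(_ i); rewrite !inE eqxx andbT => /esym/negbFE/eqP ->.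
  by rewrite eqxx.
rewrite count; apply: contraTT => _; elim/big_ind: _ => //= [x y /negbTE ox /negbTE oy|r dr].
  by rewrite oddD ox oy.
by apply: colorless_room_doors => //; have := h r; rewrite dr.
Qed.
End scarf.

From mathcomp Require Import all_classical all_reals all_analysis.
From mathcomp Require Import measurable_realfun zify ring lra.
Import Order.TTheory GRing.Theory Num.Theory.
Import numFieldNormedType.Exports.
Local Open Scope classical_set_scope.
Local Open Scope ring_scope.

(** * Brouwer's fixed point theorem *)

(** Tychonoff's theorem gives a cluster point [l]; [sigma n] is chosen to match [l] within [1/(n+1)]
    at the finitely many [j] of code below [n]. [sigma] need not be monotone. *)
Lemma bounded_subsequence (R : realType) (J : countType) (u : nat -> J -> R) (r : R) :
  (forall n j, `|u n j| <= r) ->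
  exists2 sigma : nat -> nat, (forall n, (n <= sigma n)%N) &
  exists l : J -> R, forall j, u (sigma n) j @[n --> \oo] --> l j.
Proof.
move=> ur.
have := @tychonoff J (fun=> R) (fun=> `[- r, r]%classic) (fun=> @segment_compact _ _ _).
move=> /(_ (u @ \oo) _)[|l [_ lu]].
  by exists 0%N => // n _ j /=; rewrite in_itv /= -ler_norml.
have close n : exists k, (n <= k)%N /\ forall j, (pickle j < n)%N ->
    `|u k j - l j| < n.+1%:R^-1.
  pose P : topologicalType := prod_topology (fun _ : J => R).
  pose B : set P :=
    [set f | forall (i : 'I_n) j, unpickle i = Some j -> `|f j - l j| < n.+1%:R^-1].
  have nB : nbhs (l : P) B.
    apply: (filter_forall (nbhs_filter (l : P))) => i.
    case: (unpickle i) => [j|]; last exact: (filterS _ (@filterT _ _ (nbhs_filter (l : P)))).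
    have nj : nbhs (l j) [set z | `|z - l j| < n.+1%:R^-1].
      have n0 : 0 < n.+1%:R^-1 :> R by rewrite invr_gt0.
      by apply/nbhs_ballP; exists n.+1%:R^-1 => //= z; rewrite /ball/= distrC.
    have := @proj_continuous J (fun=> R) j l _ nj.
    by apply: (@filterS _ _ (nbhs_filter (l : P))) => h hj _ [<-].
  have [_ [[k nk <-] Buk]] := lu [set u k | k in [set k | (n <= k)%N]] B
    (ex_intro2 _ _ n I (fun k nk => ex_intro2 _ _ k nk erefl)) nB.
  by exists k; split => // j jn; apply: (Buk (Ordinal jn)); exact: pickleK.
have [sigma hs] := choice close.
exists sigma => [n|]; first by have [] := hs n.
exists l => j; apply/cvgrPdist_lt => e e0.
near=> n; rewrite distrC; apply: (@lt_trans _ _ n.+1%:R^-1).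
  apply: (hs n).2; near: n; exact: nbhs_infty_gt.
near: n; exact: near_infty_natSinv_lt (PosNum e0).
Unshelve. all: by end_near. Qed.

Section simplex.
Context {R : realType} {I : finType}.

Definition simplex : set (I -> R) := [set x : I -> R | (forall i, 0 <= x i) /\ \sum_i x i = 1].

Lemma simplex_le1 (x : I -> R) i : simplex x -> x i <= 1.
Proof.
by move=> [x0 <-]; rewrite (bigD1 i)//= lerDl sumr_ge0.
Qed.

(** Scarf's lemma is applied to the points with denominator [M], ordered by each coordinate and
    coloured by a coordinate that [f] does not lower. The resulting set [s] is small, so each colour
    has a witness near [z]; a coordinate outside [C] is itself small. *)
Lemma approximate_fixpoint (f : (I -> R) -> (I -> R)) (M : nat) (i0 : I) :
  (0 < M)%N -> (forall x, simplex x -> simplex (f x)) ->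
  exists2 z, simplex z & forall i, exists z', [/\ simplex z',
    forall j, `|z' j - z j| <= #|I|%:R / M%:R & z' i <= f z' i + #|I|%:R / M%:R].
Proof.
move=> M0 fS.
pose T : finType := {x : {ffun I -> 'I_M.+1} | (\sum_i (x i : nat))%N == M}.
have mk (y : I -> nat) : (\sum_i y i)%N = M -> exists t : T, forall i, val t i = y i :> nat.
  move=> yM; pose y' := [ffun i => inord (y i) : 'I_M.+1].
  have y'E i : y' i = y i :> nat.
    by rewrite ffunE inordK// ltnS -yM (bigD1 i)//= leq_addr.
  have y'M : (\sum_i (y' i : nat))%N == M.
    by apply/eqP; apply: etrans yM; exact: eq_bigr.
  by exists (Sub y' y'M).
(* The coordinate is the leading digit in base [B]; [enum_rank] breaks ties, so that [g i] is
   injective. *)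
pose B := #|T|; pose g (i : I) (x : T) := (val x i * B + enum_rank x)%N.
have g_inj i : injective (g i).
  move=> x y; rewrite /g => /(congr1 (modn^~ B)).
  rewrite !modnMDl !modn_small// => /val_inj; exact: enum_rank_inj.
have g_le i (x y : T) : (g i x <= g i y)%N -> (val x i <= val y i)%N.
  rewrite /g; have := ltn_ord (enum_rank x); have := ltn_ord (enum_rank y).
  by rewrite -/B; nia.
have [|t0 _] := mk (fun i => if i == i0 then M else 0%N).
  by rewrite -big_mkcond big_pred1_eq.
pose pt (x : T) (i : I) : R := (val x i)%:R / M%:R.
have M0' : 0 < M%:R :> R by rewrite ltr0n.
have ptS x : simplex (pt x).
  split=> [i|]; first by rewrite divr_ge0.
  by rewrite -mulr_suml -natr_sum (eqP (valP x)) divff// gt_eqF.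
(* The default is never taken: a point and its image both have sum 1, so [f] cannot lower every
   coordinate. *)
pose c (x : T) := odflt i0 [pick i | pt x i <= f (pt x) i].
have cP x : pt x (c x) <= f (pt x) (c x).
  rewrite /c; case: pickP => [//|/= h].
  have : \sum_i f (pt x) i < \sum_i pt x i.
    apply: ltr_sum => [|i _]; last by rewrite ltNge h.
    by apply/hasP; exists i0; rewrite ?mem_index_enum.
  by rewrite (ptS x).2 (fS _ (ptS x)).2 ltxx.
have [s [C [dom cs]]] := scarf c i0 t0 g_inj.
have [i1 i1C _] := dominantP g s C dom t0.
have /imsetP[x0 x0s _] : i1 \in c @: s by rewrite cs.
pose m i := [arg min_(x < x0 in s) g i x].
have ms i : m i \in s by rewrite /m; case: arg_minnP.
(* The lower corner of [s] in the coordinates of [C]. *)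
pose b i : nat := if i \in C then (val (m i) i : nat) else 0%N.
have b_le (x : T) i : x \in s -> (b i <= val x i)%N.
  rewrite /b; case: ifP => // _ xs; apply: g_le.
  by rewrite /m; case: arg_minnP => // y ys; apply.
(* Otherwise some grid point exceeds [b] by at least one on all of [C], the spare mass being put on
   [i1]; this contradicts dominance. *)
have sumb : (M < \sum_i b i + #|C|)%N.
  rewrite ltnNge; apply/negP => h.
  have [|y yE] := mk (fun i => (b i + (i \in C) + (i == i1) * (M - (\sum_i b i + #|C|)))%N).
    rewrite !big_split/= [X in (_ + _ + X)%N](bigD1 i1)//= eqxx mul1n.
    rewrite [X in (_ + _ + (_ + X))%N]big1 => [|i /negbTE ->//].
    have -> : (\sum_i (i \in C) = #|C|)%N.
      by rewrite -sum1_card [RHS]big_mkcond/=; apply: eq_bigr => j _; case: (j \in C).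
    by rewrite addn0 subnKC.
  have [i iC hi] := dominantP g s C dom y.
  have := g_le _ _ _ (hi _ (ms i)); rewrite yE /b iC; lia.
(* All coordinates of [x] are at least those of [b] and sum to [M], so by [sumb] none exceeds [b] by
   [#|C|] or more. *)
have x_lt (x : T) i : x \in s -> (val x i < b i + #|I|)%N.
  move=> xs; have xM : (\sum_j val x j = M)%N := eqP (valP x).
  rewrite (bigD1 i)//= in xM; move: sumb; rewrite (bigD1 i)//=.
  have : (\sum_(j | j != i) b j <= \sum_(j | j != i) val x j)%N.
    by apply: leq_sum => j _; exact: b_le.
  have : (#|C| <= #|I|)%N := max_card _.
  move: xM; move: (#|C|) (#|I|) (val x i : nat) (\sum_(j | _) b j)%N.
  move: (\sum_(j | _) val x j)%N => p1 p2 p3 p4 p5; lia.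
have close (x y : T) i : x \in s -> y \in s -> `|pt x i - pt y i| <= #|I|%:R / M%:R.
  move=> xs ys; rewrite -mulrBl normrM (gtr0_norm (x := _^-1)) ?invr_gt0//.
  rewrite ler_pM2r ?invr_gt0// ler_norml.
  have := x_lt _ i xs; have := x_lt _ i ys.
  have := b_le _ i xs; have := b_le _ i ys.
  set p := (val x i : nat); set q := (val y i : nat) => h1 h2 h3 h4.
  by rewrite lerNl opprB !lerBlDr -!natrD !ler_nat; apply/andP; split; lia.
exists (pt x0); first exact: ptS.
move=> i; have [iC|iC] := boolP (i \in C); last first.
  exists (pt x0); split=> [|j|]; first exact: ptS.
    by rewrite subrr normr0 divr_ge0.
  rewrite -[leLHS]add0r lerD ?(fS _ (ptS x0)).1//.
  rewrite ler_pM2r ?invr_gt0// ler_nat; have := x_lt _ i x0s.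
  by rewrite /b (negbTE iC) => /ltnW.
have /imsetP[x xs ix] : i \in c @: s by rewrite cs.
exists (pt x); split=> [|j|]; [exact: ptS|exact: close|].
by rewrite ix (le_trans (cP x))// lerDl divr_ge0.
Qed.

(* Continuity is required along sequences of points of the simplex only. *)
Theorem brouwer_simplex (f : (I -> R) -> (I -> R)) (i0 : I) :
  (forall x, simplex x -> simplex (f x)) ->
  (forall (u : nat -> I -> R) x, (forall n, simplex (u n)) -> simplex x ->
    (forall i, u n i @[n --> \oo] --> x i) ->
    forall i, f (u n) i @[n --> \oo] --> f x i) ->
  exists2 x, simplex x & f x = x.
Proof.
move=> fS fc.
have /choice[u0 hu0] : forall n, exists z, simplex z /\ forall i, exists z', [/\ simplex z',
    forall j, `|z' j - z j| <= #|I|%:R / n.+1%:R &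
    z' i <= f z' i + #|I|%:R / n.+1%:R].
  by move=> n; have [z zS hz] := approximate_fixpoint i0 (ltn0Sn n) fS; exists z.
have u0S n := (hu0 n).1.
have u01 n j : `|u0 n j| <= 1 by rewrite ger0_norm ?(u0S n).1// simplex_le1.
have [sigma sn [l ul]] := bounded_subsequence u01.
pose eps n : R := #|I|%:R / (sigma n).+1%:R.
have eps0 : eps n @[n --> \oo] --> 0.
  apply: (@squeeze_cvgr _ _ _ _ (cst 0) (fun n => #|I|%:R * n.+1%:R^-1)).
  - apply: nearW => n; rewrite divr_ge0//= /eps ler_wpM2l//.
    by rewrite lef_pV2 ?posrE// ler_nat ltnS.
  - exact: cvg_cst.
  - rewrite -[X in _ --> X](mulr0 #|I|%:R).
    by apply: cvgM; [exact: cvg_cst|exact: cvg_harmonic].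
have lS : simplex l.
  split=> [i|].
    by apply: (cvgr_to_ge (ul i)); apply: nearW => n; exact: (u0S _).1.
  have : \sum_i u0 (sigma n) i @[n --> \oo] --> \sum_i l i.
    by apply: cvg_big => //; exact: add_continuous.
  under eq_cvg do rewrite (u0S _).2.
  by move/cvg_lim => <-//; rewrite lim_cst.
(* The witnesses for the coordinate [i] also converge to [l]. As [l] and [f l] have equal sums,
   these inequalities will force equality. *)
have fl i : l i <= f l i.
  have /choice[v hv] : forall n, exists z', [/\ simplex z',
      forall j, `|z' j - u0 (sigma n) j| <= eps n & z' i <= f z' i + eps n].
    by move=> n; exact: (hu0 (sigma n)).2.
  have vl j : v n j @[n --> \oo] --> l j.
    rewrite -[l j]addr0 (_ : v ^~ j = (fun n => u0 (sigma n) j + (v n j - u0 (sigma n) j))).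
      apply: cvgD => //; apply: (@squeeze_cvgr _ _ _ _ (fun n => - eps n) eps).
      - by apply: nearW => n; rewrite -ler_norml; have [_ + _] := hv n; exact.
      - by rewrite -[X in _ --> X]oppr0; exact: cvgN.
      - exact: eps0.
    by apply/funext => n; rewrite addrC subrK.
  rewrite -[leRHS]addr0; apply: ler_cvg_to (vl i) _ _; last first.
    by apply: nearW => n; have [_ _] := hv n; exact.
  apply: cvgD => //; apply: fc => // n; by have [] := hv n.
exists l => //; apply/funext => i; apply/eqP; rewrite eq_le fl andbT leNgt.
apply/negP => lt; have : \sum_i l i < \sum_i f l i.
  by rewrite (bigD1 i)//= [ltRHS](bigD1 i)//= ltr_leD// ler_sum.
by rewrite lS.2 (fS _ lS).2 ltxx.
Qed.
End simplex.

(** An affine change of coordinates carries [[-b, b]] to [[0, 1/N]] in each of the [N] coordinates.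
    Their sum is then at most 1, and the extra vertex [inl tt] takes up the remaining mass. *)
Theorem brouwer_bounded (R : realType) (J : finType) (G : (J -> R) -> (J -> R)) (r : R) :
  (forall x j, `|G x j| <= r) ->
  (forall (u : nat -> J -> R) x, (forall j, u n j @[n --> \oo] --> x j) ->
    forall j, G (u n) j @[n --> \oo] --> G x j) ->
  exists x, G x = x.
Proof.
move=> Gr Gc; have [J0|J0] := posnP #|J|.
  exists (fun=> 0); apply/funext => j; have := card0_eq J0 j.
  by rewrite !inE.
pose b := `|r| + 1; have b0 : 0 < b by rewrite ltr_wpDl.
have Gb x j : `|G x j| <= b by rewrite (le_trans (Gr _ _))// ler_wpDr// ler_norm.
pose N : R := #|J|%:R; have N0 : 0 < N by rewrite ltr0n.
pose emb (x : unit + J -> R) j := b * (2 * N * x (inr j) - 1).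
pose h x j := (G (emb x) j + b) / (2 * N * b).
have den : 0 < 2 * N * b by rewrite !mulr_gt0.
have h0 x j : 0 <= h x j.
  apply: divr_ge0; last exact: ltW.
  by rewrite -lerBlDr sub0r; have := Gb (emb x) j; rewrite ler_norml => /andP[].
have h1 x j : h x j <= N^-1.
  rewrite ler_pdivrMr// (_ : N^-1 * _ = b + b); last by field; rewrite ?gt_eqF.
  by rewrite lerD2r (le_trans (ler_norm _)).
pose F x (i : unit + J) := if i is inr j then h x j else 1 - \sum_j h x j.
have FS x : simplex x -> simplex (F x).
  move=> _; split=> [[_|j] /=|]; last 2 first.
  - exact: h0.
  - rewrite big_sumType/= (_ : \sum_(i : unit) _ = 1 - \sum_j h x j) ?subrK//.
    by rewrite (big_pred1 tt)//; case.
  rewrite subr_ge0 (le_trans (ler_sum _ (fun j _ => h1 x j)))//.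
  by rewrite sumr_const -/N -[_ *+ _]mulr_natr mulVf// gt_eqF.
have [|x _ Fx] := brouwer_simplex (inl tt) FS.
  move=> u x _ _ ux.
  have hc j : h (u n) j @[n --> \oo] --> h x j.
    apply: cvgM; last exact: cvg_cst.
    apply: cvgD; last exact: cvg_cst.
    apply: Gc => {}j; apply: cvgM; first exact: cvg_cst.
    by apply: cvgB; [apply: cvgM; [exact: cvg_cst|exact: ux]|exact: cvg_cst].
  case=> [_|j] //=; apply: cvgB; first exact: cvg_cst.
  by apply: cvg_big => //; exact: add_continuous.
exists (emb x); apply/funext => j.
rewrite [RHS]/emb -[in RHS]Fx /= /h; field.
by rewrite !gt_eqF.
Qed.

(** * The integral operator *)

Section integral_operator.
Context d (T : measurableType d) (R : realType) (mu : {measure set T -> \bar R}).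
Variables (D : set T) (k : R -> T -> R) (m h : T -> R).
Hypotheses (mD : measurable D) (h0 : forall s, D s -> 0 <= h s)
  (m0 : forall s, D s -> 0 <= m s)
  (mk : forall t : R, t \in `[0, 1] -> measurable_fun D (k t))
  (mm : measurable_fun D m) (mh : measurable_fun D h)
  (ikh : forall t : R, t \in `[0, 1] -> mu.-integrable D (EFin \o (k t \* h)))
  (imh : mu.-integrable D (EFin \o (m \* h)))
  (tvk : {ae mu, forall s, D s -> (total_variation 0 1 (k ^~ s) <= (m s)%:E)%E})
  (ck : forall tau : R, tau \in `[0, 1] ->
     (fun t => \int[mu]_(s in D) (`|k t s - k tau s| * h s)%:E)%E
       @ within `[0, 1] (nbhs tau) --> 0%E).

Let in0 : (0 : R) \in `[0, 1]. Proof. by rewrite in_itv /= lexx ler01. Qed.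

Let integrableR (f g : T -> R) : measurable_fun D f ->
  (forall s, D s -> `|f s| <= g s) -> mu.-integrable D (EFin \o g) ->
  mu.-integrable D (EFin \o f).
Proof.
move=> mf fg; apply: le_integrable => //; first exact/measurable_EFinP.
by move=> s Ds /=; rewrite lee_fin (le_trans (fg _ Ds))// ler_norm.
Qed.

(* The operator vanishes outside [0,1], so that it is linear as a map into functions on R. *)
Definition intop (g : T -> R) (t : R) : R :=
  if t \in `[0, 1] then \int[mu]_(s in D) (k t s * g s) else 0.

(** By [tvk] this dominates the BV norm of the section [k ^~ s] for almost every [s]. *)
Definition intop_weight (s : T) : R := `|k 0 s| + m s.

Definition intop_bound (g : T -> R) : R :=
  \int[mu]_(s in D) (intop_weight s * `|g s|).

Definition majorized (c : R) (g : T -> R) : Prop :=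
  measurable_fun D g /\ forall s, D s -> `|g s| <= c * h s.

Lemma majorizedB c1 c2 g1 g2 : majorized c1 g1 -> majorized c2 g2 ->
  majorized (c1 + c2) (g1 \- g2).
Proof.
move=> [mg1 b1] [mg2 b2]; split; first exact: measurable_funB.
move=> s Ds; rewrite mulrDl (le_trans (ler_normB _ _))// lerD//.
  exact: b1.
exact: b2.
Qed.

Lemma integrable_kernelM c g (t : R) : t \in `[0, 1] -> majorized c g ->
  mu.-integrable D (EFin \o (k t \* g)).
Proof.
move=> t01 [mg gh].
apply: (@integrableR _ (fun s => c * `|k t s * h s|)).
- by apply: measurable_funM => //; exact: mk.
- move=> s Ds /=; rewrite normrM [`|k t s * _|]normrM (ger0_norm (h0 Ds)).
  by rewrite mulrCA ler_wpM2l// gh.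
- exact: (integrableZl mD c (integrable_norm (ikh t01))).
Qed.

Let mw : measurable_fun D intop_weight.
Proof.
apply: measurable_funD => //; apply: measurableT_comp => //.
exact: mk.
Qed.

Let w0 s : D s -> 0 <= intop_weight s.
Proof. by move=> Ds; rewrite addr_ge0 ?m0. Qed.

Lemma integrable_weightM c g : majorized c g ->
  mu.-integrable D (EFin \o (fun s => intop_weight s * `|g s|)).
Proof.
move=> mg; have [mg1 gh] := mg.
apply: (@integrableR _ (fun s => `|k 0 s * g s| + c * (m s * h s))).
- by apply: measurable_funM => //; exact: measurableT_comp.
- move=> s Ds /=; rewrite normrM normr_id (ger0_norm (w0 Ds)) mulrDl normrM lerD2l.
  by rewrite mulrCA ler_wpM2l ?gh// m0.
- exact: (integrableD mD (integrable_norm (integrable_kernelM in0 mg))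
    (integrableZl mD c imh)).
Qed.

Lemma le_intopB c g (a b : R) : majorized c g -> a \in `[0, 1] -> b \in `[0, 1] ->
  (`|intop g a - intop g b|%:E <= \int[mu]_(s in D) (`|k a s - k b s| * `|g s|)%:E)%E.
Proof.
move=> mg a01 b01; have [mg1 _] := mg.
have ia := integrable_kernelM a01 mg; have ib := integrable_kernelM b01 mg.
rewrite /intop a01 b01 -RintegralB// EFin_normr_Rintegral//; last first.
  exact: (integrableB mD ia ib).
have mab : measurable_fun D (fun s => k a s * g s - k b s * g s).
  by apply: measurable_funB; apply: measurable_funM => //; exact: mk.
apply: le_trans (le_abse_integral _ _ _) _ => //; first exact/measurable_EFinP.
apply: ge0_le_integral => //=.
- have : measurable_fun D (fun s => (`|k a s * g s - k b s * g s|)%:E).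
    by apply/measurable_EFinP; exact: measurableT_comp.
  by [].
- apply/measurable_EFinP; apply: measurable_funM; apply: measurableT_comp => //.
  by apply: measurable_funB; exact: mk.
- by move=> s Ds; rewrite lee_fin -mulrBl normrM.
Qed.

(** Since [g] enters only through its bound [h], the [delta] given by [ck] at [tau] serves all [g]
    at once. *)
Lemma intop_equicontinuous (tau e : R) : tau \in `[0, 1] -> 0 < e ->
  exists2 delta, 0 < delta & forall t : R, t \in `[0, 1] -> `|t - tau| < delta ->
  forall g, majorized 1 g -> `|intop g t - intop g tau| < e.
Proof.
move=> tau01 e0; have /fine_cvgP[fink /cvgrPdist_lt/(_ _ e0)] := ck tau01.
move=> /(filterI fink)/nbhs_ballP[delta /= delta0 near_tau].
exists delta => // t t01 ttau g mg.
have tball : ball tau delta t by rewrite /ball/= distrC.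
have [fint] := near_tau t tball t01.
rewrite /= sub0r normrN => ltint.
rewrite -lte_fin; apply: le_lt_trans (le_intopB mg t01 tau01) _.
apply: (@le_lt_trans _ _ (\int[mu]_(s in D) (`|k t s - k tau s| * h s)%:E)%E).
  have mkk : measurable_fun D (fun s => `|k t s - k tau s|).
    by apply: measurableT_comp => //; apply: measurable_funB; exact: mk.
  have [mg1 gh] := mg; apply: ge0_le_integral => //.
  - by apply/measurable_EFinP; apply: measurable_funM => //; exact: measurableT_comp.
  - by apply/measurable_EFinP; exact: measurable_funM.
  - by move=> s Ds; rewrite lee_fin ler_wpM2l// (le_trans (gh _ Ds))// mul1r.
rewrite -(fineK fint) lte_fin; exact: le_lt_trans (ler_norm _) ltint.
Qed.

(** For each partition the sum goes under the integral, where it becomes a variation sum of the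
    section [k ^~ s], at most [m s] almost everywhere. *)
Lemma total_variation_intop_le c g : majorized c g ->
  (total_variation 0 1 (intop g) <= \int[mu]_(s in D) (m s * `|g s|)%:E)%E.
Proof.
move=> mg; have [mg1 _] := mg; apply: ge_ereal_sup => _ [_ [l l01 <-] <-].
have F01 (n : nat) : (n < (size l).+1)%N -> nth 1 (0 :: l) n \in `[(0:R), 1].
  by move=> nl; rewrite in_itv/= itv_partition_nth_ge// itv_partition_nth_le.
rewrite /variation big_mkord -sumEFin.
apply: (@le_trans _ _ (\sum_(i < size l) \int[mu]_(s in D)
    (`|k (nth 1 (0 :: l) i.+1) s - k (nth 1 (0 :: l) i) s| * `|g s|)%:E)%E).
  apply: lee_sum => i _; apply: (le_intopB mg); apply: F01.
    by rewrite ltnS.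
  by rewrite ltnS ltnW.
have mkk (i : 'I_(size l)) : measurable_fun D (fun s =>
    (`|k (nth 1 (0 :: l) i.+1) s - k (nth 1 (0 :: l) i) s| * `|g s|)%:E).
  apply/measurable_EFinP; apply: measurable_funM; apply: measurableT_comp => //.
  by apply: measurable_funB; apply: mk; apply: F01; rewrite ltnS// ltnW.
rewrite -ge0_integral_sum//; apply: ae_ge0_le_integral => //.
- by move=> s Ds; apply: sume_ge0 => i _; rewrite lee_fin.
- exact: emeasurable_sum.
- by move=> s Ds; rewrite lee_fin mulr_ge0// m0.
- by apply/measurable_EFinP; apply: measurable_funM => //; exact: measurableT_comp.
apply: filterS tvk => s + Ds => /(_ Ds); rewrite sumEFin lee_fin -mulr_suml => tvs.
apply: ler_wpM2r => //; rewrite -lee_fin; apply: le_trans tvs.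
apply: ereal_sup_ubound; exists (variation 0 1 (k ^~ s) l) => //.
  by exists l.
by rewrite /variation big_mkord.
Qed.

Lemma integrable_variationM c g : majorized c g ->
  mu.-integrable D (EFin \o (fun s => m s * `|g s|)).
Proof.
move=> [mg gh]; apply: (@integrableR _ (fun s => c * (m s * h s))).
- by apply: measurable_funM => //; exact: measurableT_comp.
- move=> s Ds /=; rewrite normrM normr_id (ger0_norm (m0 Ds)).
  by rewrite mulrCA ler_wpM2l ?gh// m0.
- exact: (integrableZl mD c imh).
Qed.

Lemma fin_total_variation_intop c g : majorized c g ->
  total_variation 0 1 (intop g) \is a fin_num.
Proof.
move=> mg; rewrite ge0_fin_numE ?total_variation_ge0//.
apply: le_lt_trans (total_variation_intop_le mg) _.
exact: (integrable_lty mD (integrable_variationM mg)).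
Qed.

Lemma intop_CBV g : majorized 1 g -> CBV (intop g).
Proof.
move=> mg; split.
  apply/subspace_continuousP => tau tau01; apply/cvgrPdist_lt => e e0.
  have [delta delta0 hd] := intop_equicontinuous tau01 e0.
  apply/nbhs_ballP; exists delta => //= t; rewrite /ball/= => ttau t01.
  by rewrite distrC hd// distrC.
by apply/bounded_variationP => //; exact: (fin_total_variation_intop mg).
Qed.

Lemma BVnorm_intop c g : majorized c g -> BVnorm (intop g) <= intop_bound g.
Proof.
move=> mg; have ik := integrable_norm (integrable_kernelM in0 mg).
have im := integrable_variationM mg.
have -> : intop_bound g = \int[mu]_(s in D) (`|k 0 s * g s|) +
    \int[mu]_(s in D) (m s * `|g s|).
  rewrite -RintegralD//; apply: eq_Rintegral => s _.
  by rewrite mulrDl normrM.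
apply: lerD; first by rewrite /intop in0 le_normr_Rintegral// (integrable_kernelM in0 mg).
apply: fine_le => //; first exact: (fin_total_variation_intop mg).
  exact: (integrable_fin_num mD im).
exact: (total_variation_intop_le mg).
Qed.

Lemma intop_bound_le g : majorized 1 g ->
  intop_bound g <= \int[mu]_(s in D) (intop_weight s * h s).
Proof.
move=> mg; have [_ gh] := mg; apply: le_Rintegral => //.
- exact: (integrable_weightM mg).
- have mh1 : majorized 1 h by split => // s Ds; rewrite mul1r ger0_norm// h0.
  apply: eq_integrable (integrable_weightM mh1) => // s /set_mem Ds /=.
  by rewrite ger0_norm// h0.
- by move=> s Ds; rewrite ler_wpM2l ?w0// (le_trans (gh _ Ds))// mul1r.
Qed.

(** Dominated convergence, with [c] times [intop_weight] times [h] as majorant. Through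
    [BVnorm_intop] it turns pointwise convergence into convergence in BV norm. *)
Lemma intop_bound_cvg0 c (g_ : nat -> T -> R) : (forall n, majorized c (g_ n)) ->
  {ae mu, forall s, D s -> g_ n s @[n --> \oo] --> 0} ->
  intop_bound (g_ n) @[n --> \oo] --> 0.
Proof.
move=> mg g0; apply: fine_cvg.
rewrite (_ : 0%:E = \int[mu]_(s in D) (cst 0%E s))%E; last by rewrite integral0.
have mh1 : majorized 1 h by split => // s Ds; rewrite mul1r ger0_norm// h0.
have [] := @dominated_convergence _ _ _ mu D mD
  (fun n s => (intop_weight s * `|g_ n s|)%:E) (cst 0%E)
  (fun s => (c%:E * (intop_weight s * `|h s|)%:E)%E).
- move=> n; apply/measurable_EFinP; apply: measurable_funM => //.
  by apply: measurableT_comp => //; exact: (mg n).1.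
- exact: measurable_cst.
- apply: filterS g0 => s + Ds => /(_ Ds) gs; apply/fine_cvgP; split.
    exact: nearW.
  rewrite -(mulr0 (intop_weight s)); apply: cvgM; first exact: cvg_cst.
  by rewrite -(@normr0 _ R); exact: cvg_norm.
- exact: (integrableZl mD c (integrable_weightM mh1)).
- apply: aeW => s n Ds; rewrite gee0_abs ?lee_fin ?mulr_ge0 ?w0//.
  rewrite mulrCA ler_wpM2l ?w0// (ger0_norm (h0 Ds)).
  exact: (mg n).2.
by [].
Qed.
End integral_operator.

(** * The linear boundary problem *)

(** Multiplying by the indicator of the complement of the exceptional null set makes the convergence
    hold everywhere on [D]; completeness then passes measurability on to [g]. *)
Lemma ae_measurable_fun_cvg d (T : measurableType d) (R : realType)
    (mu : {measure set T -> \bar R}) (D : set T) (g_ : nat -> T -> R) (g : T -> R) :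
  measure_is_complete mu -> (forall n, measurable_fun D (g_ n)) ->
  {ae mu, forall s, D s -> g_ n s @[n --> \oo] --> g s} -> measurable_fun D g.
Proof.
move=> cmu mg [N [mN N0 subN]].
have mind (f : T -> R) : measurable_fun D f ->
    measurable_fun D (fun s => f s * \1_(~` N) s).
  by move=> mf; apply: measurable_funM => //; apply: measurable_indic; exact: measurableC.
have mgN : measurable_fun D (fun s => g s * \1_(~` N) s).
  apply: (measurable_fun_cvg (fun n => mind _ (mg n))) => s Ds.
  have [sN|sN] := pselect (N s).
    rewrite indicE memNset ?mulr0; last by move=> /(_ sN).
    under eq_cvg do rewrite mulr0.
    exact: cvg_cst.
  apply: cvgM; last exact: cvg_cst.
  by apply: contrapT => gs; apply: sN; apply: subN => /(_ Ds).
have mgE : measurable_fun D (EFin \o (fun s => g s * \1_(~` N) s)).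
  exact/measurable_EFinP.
apply/measurable_EFinP; apply: (ae_measurable_fun cmu _ mgE).
exists N; split => // s /= h; apply: contrapT => sN; apply: h => _.
by rewrite /= indicE mem_set ?mulr1.
Qed.

Lemma cvgr_dist_squeeze (R : realType) (z e : nat -> R) (l C : R) :
  (forall n, `|l - z n| <= C * e n) -> e n @[n --> \oo] --> 0 ->
  z n @[n --> \oo] --> l.
Proof.
move=> ze e0; have Ce0 : C * e n @[n --> \oo] --> 0.
  by rewrite -(mulr0 C); apply: cvgM => //; exact: cvg_cst.
apply/cvgrPdist_lt => eps eps0; move/cvgrPdist_lt : Ce0 => /(_ _ eps0).
apply: filterS => n; rewrite sub0r normrN; apply: le_lt_trans.
by rewrite (le_trans (ze n))// ler_norm.
Qed.

(** * The space CBV[0,1] and its dual *)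

Section CBV_theory.
Context {R : realType}.
Implicit Types (x y : R -> R).

Lemma CBVZD (c : R) x y : CBV x -> CBV y -> CBV (fun t => c * x t + y t).
Proof.
move=> [cx bx] [cy by_]; split.
  move: cx cy => /subspace_continuousP cx /subspace_continuousP cy.
  apply/subspace_continuousP => t t01; apply: cvgD; last exact: cy.
  by apply: cvgM; [exact: cvg_cst|exact: cx].
apply: (@bounded_variationD _ 0 1 (fun t => c * x t) y) => //.
have [M hM] := bx; exists (`|c| * M) => _ [l l01 <-].
rewrite (_ : variation 0 1 _ l = `|c| * variation 0 1 x l).
  by apply: ler_wpM2l => //; apply: hM; exists l.
rewrite /variation mulr_sumr; apply: eq_bigr => i _.
by rewrite /= -mulrBr normrM.
Qed.

Lemma CBV_cst (a : R) : CBV (fun=> a).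
Proof.
split; first by move=> t; exact: cvg_cst.
exists 0 => _ [l l01 <-]; rewrite /variation big1// => i _.
by rewrite /= subrr normr0.
Qed.

Lemma BVnorm_ge x t : CBV x -> t \in `[0, 1] -> `|x t| <= BVnorm x.
Proof.
move=> [_ bx]; rewrite in_itv/= => /andP[t0 t1].
have ftv : total_variation 0 1 x \is a fin_num by apply/bounded_variationP.
have -> : x t = x 0 + (x t - x 0) by rewrite addrC subrK.
rewrite (le_trans (ler_normD _ _))// lerD2l -lee_fin fineK//.
rewrite (total_variationD x t0 t1).
by rewrite (le_trans (total_variation_ge x t0))// leeDl// total_variation_ge0.
Qed.

Lemma CBVdual_bound (a : (R -> R) -> R) : CBVdual a ->
  exists2 C, 0 <= C & forall x, CBV x -> `|a x| <= C * BVnorm x.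
Proof.
move=> [_ [C hC]]; exists `|C| => // x xC; rewrite (le_trans (hC _ xC))//.
by rewrite ler_wpM2r ?ler_norm// (le_trans _ (BVnorm_ge xC (t := 0) _))// in_itv/= lexx ler01.
Qed.

Lemma CBVdual_cvg (a : (R -> R) -> R) (y_ : nat -> R -> R) y : CBVdual a ->
  (forall n, CBV (y_ n)) -> CBV y ->
  BVnorm (fun t => -1 * y t + y_ n t) @[n --> \oo] --> 0 ->
  a (y_ n) @[n --> \oo] --> a y.
Proof.
move=> ad cy_ cy yy; have [C C0 hC] := CBVdual_bound ad.
have diff n : `|a y - a (y_ n)| <= C * BVnorm (fun t => -1 * y t + y_ n t).
  rewrite distrC; apply: le_trans (hC _ (CBVZD _ cy (cy_ n))).
  by rewrite ad.1// mulN1r addrC.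
exact: cvgr_dist_squeeze diff yy.
Qed.

Section lift.
Variables (alpha beta : (R -> R) -> R) (v w : R -> R).
Hypotheses (ad : CBVdual alpha) (bd : CBVdual beta) (cv : CBV v)
  (alpha1 : alpha (fun=> 1) = 0) (beta1 : beta (fun=> 1) = 0)
  (ab : `|alpha v - beta v| < 1) (vw : forall t, t \in `[0, 1] -> v t + w t = 1).

Let dv := alpha v - beta v.
(** With [w = 1 - v] the equation reads [x = (alpha x - beta x) v + beta x + y]. Applying
    [alpha - beta], then [beta], shows that [slope y] is [alpha x - beta x] and [offset y] is
    [beta x]. *)
Let slope y := (alpha y - beta y) / (1 - dv).
Let offset y := slope y * beta v + beta y.

(* The solution operator of the linear equation [x = alpha x * v + beta x * w + y]. *)
Definition lift y (t : R) : R := slope y * v t + (offset y * 1 + y t).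

Let den0 : 1 - dv != 0.
Proof. by rewrite subr_eq0 eq_sym lt_eqF// (le_lt_trans (ler_norm _)). Qed.

Let CBV_offset y : CBV y -> CBV (fun t => offset y * 1 + y t).
Proof. by move=> cy; apply: CBVZD => //; exact: CBV_cst. Qed.

Lemma CBV_lift y : CBV y -> CBV (lift y).
Proof. by move=> cy; apply: CBVZD => //; exact: CBV_offset. Qed.

Let lift_alpha y : CBV y -> alpha (lift y) = slope y * alpha v + alpha y.
Proof.
move=> cy; rewrite ad.1//; last exact: CBV_offset.
by rewrite (ad.1 _ (fun=> 1))//; [rewrite alpha1 mulr0 add0r|exact: CBV_cst].
Qed.

Let lift_beta y : CBV y -> beta (lift y) = offset y.
Proof.
move=> cy; rewrite bd.1//; last exact: CBV_offset.
by rewrite (bd.1 _ (fun=> 1))//; [rewrite beta1 mulr0 add0r|exact: CBV_cst].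
Qed.

Lemma liftP y t : CBV y -> t \in `[0, 1] ->
  lift y t = alpha (lift y) * v t + beta (lift y) * w t + y t.
Proof.
move=> cy t01; rewrite lift_alpha// lift_beta//.
have -> : w t = 1 - v t by rewrite -(vw t01) addrC addKr.
have sE : slope y * (1 - dv) = alpha y - beta y by rewrite divfK.
rewrite /lift /offset; rewrite /dv in sE.
have -> : alpha y = beta y + slope y * (1 - (alpha v - beta v)) by rewrite sE addrC subrK.
ring.
Qed.

Lemma lift_bound : exists2 C, 0 <= C &
  forall y t, CBV y -> t \in `[0, 1] -> `|lift y t| <= C * BVnorm y.
Proof.
have [A A0 hA] := CBVdual_bound ad; have [B B0 hB] := CBVdual_bound bd.
pose S := (A + B) / `|1 - dv|.
have S0 : 0 <= S by rewrite divr_ge0// addr_ge0.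
have v0 : 0 <= BVnorm v.
  by rewrite (le_trans _ (BVnorm_ge cv (t := 0) _))// in_itv/= lexx ler01.
exists (S * BVnorm v + (S * `|beta v| + B + 1)).
  have SV : 0 <= S * BVnorm v by exact: mulr_ge0.
  have Sb : 0 <= S * `|beta v| by exact: mulr_ge0.
  by rewrite !addr_ge0.
move=> y t cy t01; have yb := BVnorm_ge cy t01; have vb := BVnorm_ge cv t01.
have y0 : 0 <= BVnorm y by exact: le_trans yb.
have sb : `|slope y| <= S * BVnorm y.
  rewrite normrM normfV mulrAC ler_pM2r ?invr_gt0 ?normr_gt0//.
  by rewrite mulrDl (le_trans (ler_normB _ _))// lerD ?hA ?hB.
rewrite /lift /offset mulr1 (le_trans (ler_normD _ _))// mulrDl lerD//.
  by rewrite normrM mulrAC ler_pM.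
rewrite !mulrDl mul1r (le_trans (ler_normD _ _))// lerD//.
rewrite (le_trans (ler_normD _ _))// lerD ?hB//.
by rewrite normrM mulrAC ler_wpM2r.
Qed.

Lemma lift_modulus : exists2 S, 0 <= S & forall y s t, CBV y ->
  `|lift y t - lift y s| <= S * BVnorm y * `|v t - v s| + `|y t - y s|.
Proof.
have [A A0 hA] := CBVdual_bound ad; have [B B0 hB] := CBVdual_bound bd.
exists ((A + B) / `|1 - dv|) => [|y s t cy]; first by rewrite divr_ge0// addr_ge0.
have -> : lift y t - lift y s = slope y * (v t - v s) + (y t - y s).
  by rewrite /lift; ring.
rewrite (le_trans (ler_normD _ _))// lerD2r normrM ler_wpM2r//.
rewrite normrM normfV mulrAC ler_pM2r ?invr_gt0 ?normr_gt0//.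
by rewrite mulrDl (le_trans (ler_normB _ _))// lerD ?hA ?hB.
Qed.

Lemma lift_cvg (y_ : nat -> R -> R) y t :
  (forall n, CBV (y_ n)) -> CBV y -> t \in `[0, 1] ->
  BVnorm (fun t => -1 * y t + y_ n t) @[n --> \oo] --> 0 ->
  lift (y_ n) t @[n --> \oo] --> lift y t.
Proof.
move=> cy_ cy t01 yy.
have slope_cvg : slope (y_ n) @[n --> \oo] --> slope y.
  by apply: cvgM; [apply: cvgB; exact: CBVdual_cvg|exact: cvg_cst].
apply: cvgD; first by apply: cvgM => //; exact: cvg_cst.
apply: cvgD.
  apply: cvgM; last exact: cvg_cst.
  apply: cvgD; last exact: CBVdual_cvg.
  by apply: cvgM => //; exact: cvg_cst.
apply: (@cvgr_dist_squeeze _ _ _ _ 1 _ yy) => n; rewrite mul1r distrC.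
have := BVnorm_ge (CBVZD (-1) cy (cy_ n)) t01.
by rewrite mulN1r addrC.
Qed.
End lift.
End CBV_theory.

(** * Existence for a bounded nonlinearity *)

Lemma is_interval_lebesgue_measurable (R : realType) (A : set R) :
  is_interval A -> measurable (A : set (@LebR R)).
Proof. by move=> /is_interval_measurable mA; exact: sub_caratheodory. Qed.

Lemma measurable_I01 (R : realType) : measurable (@I01 R).
Proof. by apply: is_interval_lebesgue_measurable; exact: interval_is_interval. Qed.

(** * Uniform grids and step functions *)

Section grid.
Context {R : realType}.
Implicit Types s t : R.

(** The minimum with [n] puts [s = 1] into the last of the [n.+1] cells. *)
Definition grid_idx n s : 'I_n.+1 := inord (minn (Num.truncn (s * n.+1%:R)) n).

(** Capping the index keeps the point in [0,1] for every natural [i], so that all grids together can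
    be indexed by [nat * nat]. *)
Definition grid_point n (i : nat) : R := (minn i n)%:R / n.+1%:R.

Lemma grid_point01 n i : grid_point n i \in `[0, 1].
Proof.
rewrite in_itv/= divr_ge0//= ler_pdivrMr// mul1r ler_nat.
by rewrite (leq_trans (geq_minr _ _)).
Qed.

Lemma grid_point_close n s : s \in `[0, 1] ->
  `|grid_point n (grid_idx n s) - s| <= n.+1%:R^-1.
Proof.
rewrite in_itv/= => /andP[s0 s1]; have n0 : 0 < n.+1%:R :> R by [].
have /andP[lo hi] : (Num.truncn (s * n.+1%:R))%:R <= s * n.+1%:R <
  (Num.truncn (s * n.+1%:R)).+1%:R by apply: truncn_itv; rewrite mulr_ge0.
rewrite /grid_point /grid_idx inordK ?ltnS ?geq_minr// (minn_idPl (geq_minr _ _)).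
set q := Num.truncn _ in lo hi *.
have sE : s = (s * n.+1%:R) / n.+1%:R by rewrite mulfK// gt_eqF.
rewrite [X in _ - X]sE -mulrBl normrM (gtr0_norm (x := _^-1)) ?invr_gt0//.
rewrite ler_piMl ?invr_ge0// ler_norml.
have s1' : s * n.+1%:R <= n.+1%:R by rewrite ler_piMl.
rewrite -natr1 in hi; rewrite -natr1 in s1'.
have [qn|nq] := leqP q n; apply/andP; split; try lra.
have : (n.+1)%:R <= q%:R :> R by rewrite ler_nat.
by rewrite -natr1; lra.
Qed.

(** [grid_idx n] is monotone, so its fibres are intervals, and on each of them the second argument
    of [F] is constant. *)
Lemma measurable_step (F : R -> R -> R) n (c : 'I_n.+1 -> R) :
  (forall u, leb_meas01 (F ^~ u)) -> leb_meas01 (fun s => F s (c (grid_idx n s))).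
Proof.
move=> mF mD B mB.
rewrite (_ : _ `&` _ = \big[setU/set0]_(i < n.+1)
    ([set s | grid_idx n s = i] `&` (I01 `&` (F ^~ (c i)) @^-1` B))).
  apply: bigsetU_measurable => i _; apply: measurableI; last exact: mF.
  apply: is_interval_lebesgue_measurable => s t /= si ti z /andP[sz zt].
  have leidx a b : a <= b -> (minn (Num.truncn (a * n.+1%:R)) n <=
      minn (Num.truncn (b * n.+1%:R)) n)%N.
    move=> ab; have : (Num.truncn (a * n.+1%:R) <= Num.truncn (b * n.+1%:R))%N.
      by apply: le_truncn; rewrite ler_wpM2r.
    lia.
  have idxE a : grid_idx n a = minn (Num.truncn (a * n.+1%:R)) n :> nat.
    by rewrite inordK// ltnS geq_minr.
  apply: val_inj => /=; rewrite idxE; apply/eqP; rewrite eqn_leq.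
  by rewrite -{1}ti -si !idxE !leidx.
rewrite -bigcup_mkord_ord; apply/seteqP; split=> [s [Ds Bs]|s].
  by exists (val (grid_idx n s)); [exact: ltn_ord|rewrite inord_val].
by move=> [i _ [/= <- [Ds Bs]]].
Qed.
End grid.

(** * Finite-dimensional approximation and passage to the limit *)

Section hammerstein.
Context {R : realType}.
Variables (alpha beta : (R -> R) -> R) (v w : R -> R).
Hypotheses (ad : CBVdual alpha) (bd : CBVdual beta) (cv : CBV v)
  (alpha1 : alpha (fun=> 1) = 0) (beta1 : beta (fun=> 1) = 0)
  (ab : `|alpha v - beta v| < 1) (vw : forall t, t \in `[0, 1] -> v t + w t = 1).
Variables (k : R -> @LebR R -> R) (m h : @LebR R -> R) (F : R -> R -> R).
Hypotheses (h0 : forall s : LebR, I01 s -> 0 <= h s)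
  (m0 : forall s : LebR, I01 s -> 0 <= m s)
  (mk : forall t : R, t \in `[0, 1] -> measurable_fun I01 (k t))
  (mm : measurable_fun I01 m) (mh : measurable_fun I01 h)
  (ikh : forall t : R, t \in `[0, 1] -> leb.-integrable I01 (EFin \o (k t \* h)))
  (imh : leb.-integrable I01 (EFin \o (m \* h)))
  (tvk : {ae leb, forall s, I01 s -> (total_variation 0 1 (k ^~ s) <= (m s)%:E)%E})
  (ck : forall tau : R, tau \in `[0, 1] ->
     (fun t => \int[leb]_(s in I01) (`|k t s - k tau s| * h s)%:E)%E
       @ within `[0, 1] (nbhs tau) --> 0%E)
  (mF : forall u, leb_meas01 (F ^~ u))
  (cF : {ae leb, forall s : LebR, I01 s -> continuous (F s)})
  (Fh : forall s u, s \in `[0, 1] -> `|F s u| <= h s).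

Let mI := @measurable_I01 R.

Let admissible (x : R -> R) := leb_meas01 (fun s => F s (x s)).

Let N (x : R -> R) : @LebR R -> R := fun s => F s (x s).

Let K (x : R -> R) : R -> R := intop leb I01 k (N x).

Let W : R := \int[leb]_(s in I01) (intop_weight k m s * h s).

Let majN x : admissible x -> majorized I01 h 1 (N x).
Proof. by move=> ax; split => // s Ds; rewrite mul1r Fh. Qed.

Let K_CBV x : admissible x -> CBV (K x).
Proof. by move=> ax; exact: (intop_CBV mI h0 m0 mk mm mh ikh imh tvk ck (majN ax)). Qed.

Let K_norm x : admissible x -> BVnorm (K x) <= W.
Proof.
move=> ax; apply: (@le_trans _ _ (intop_bound leb I01 k m (N x))).
  exact: (BVnorm_intop mI h0 m0 mk mm ikh imh tvk (majN ax)).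
exact: (intop_bound_le mI h0 m0 mk mm mh ikh imh (majN ax)).
Qed.

Let T x := lift alpha beta v (K x).

(** By continuity of [F s], the functions [N (x_ n)] converge almost everywhere. Completeness of the
    measure makes the limit admissible, and domination by [h] makes [K (x_ n)] converge in BV
    norm. *)
Let T_cvg (x_ : nat -> R -> R) x : (forall n, admissible (x_ n)) ->
  (forall s, s \in `[0, 1] -> x_ n s @[n --> \oo] --> x s) ->
  admissible x /\ forall t, t \in `[0, 1] -> T (x_ n) t @[n --> \oo] --> T x t.
Proof.
move=> ax_ xx.
have NN : {ae leb, forall s : LebR, I01 s -> N (x_ n) s @[n --> \oo] --> N x s}.
  apply: filterS cF => s + Ds => /(_ Ds) cFs; apply: (@cvg_comp _ _ _ _ (F s)).
    exact: xx.
  exact: cFs.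
have ax : admissible x.
  apply: (ae_measurable_fun_cvg _ ax_ NN).
  exact: completed_lebesgue_measure_is_complete.
split => // t t01; apply: lift_cvg => //; [by move=> n; exact: K_CBV|exact: K_CBV|].
have mB n : majorized I01 h (1 + 1) (N (x_ n) \- N x).
  by apply: majorizedB; exact: majN.
have KB n : (fun t => -1 * K x t + K (x_ n) t) = intop leb I01 k (N (x_ n) \- N x).
  apply/funext => s; rewrite /K /intop; case: ifPn => [s01|_]; last by rewrite mulr0 addr0.
  rewrite mulN1r addrC -RintegralB//.
  - by apply: eq_Rintegral => z _; rewrite /= mulrBr.
  - exact: (integrable_kernelM mI h0 mk ikh s01 (majN (ax_ n))).
  - exact: (integrable_kernelM mI h0 mk ikh s01 (majN ax)).
under eq_cvg do rewrite KB.
have b0 : intop_bound leb I01 k m (N (x_ n) \- N x) @[n --> \oo] --> 0.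
  apply: (intop_bound_cvg0 mI h0 m0 mk mm mh ikh imh mB).
  apply: filterS NN => s + Ds => /(_ Ds) Ns.
  by rewrite -(subrr (N x s)); apply: cvgB => //; exact: cvg_cst.
apply: (@squeeze_cvgr _ _ _ _ (cst 0) _ _ _ _ _ b0); last exact: cvg_cst.
apply: nearW => n; apply/andP; split; last first.
  exact: (BVnorm_intop mI h0 m0 mk mm ikh imh tvk (mB n)).
by rewrite addr_ge0// fine_ge0// total_variation_ge0.
Qed.

Let T_bound C x t :
  (forall y t, CBV y -> t \in `[0, 1] -> `|lift alpha beta v y t| <= C * BVnorm y) ->
  0 <= C -> admissible x -> t \in `[0, 1] -> `|T x t| <= C * W.
Proof.
move=> hC C0 ax t01; apply: le_trans (hC _ _ (K_CBV ax) t01) _.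
by rewrite ler_wpM2l// K_norm.
Qed.

Let T_equicontinuous s e : s \in `[0, 1] -> 0 < e ->
  exists2 delta, 0 < delta & forall t, t \in `[0, 1] -> `|t - s| < delta ->
  forall x, admissible x -> `|T x t - T x s| < e.
Proof.
move=> s01 e0; have [S S0 hS] := lift_modulus ad bd ab.
have e20 : 0 < e / 2 by rewrite divr_gt0.
have [d1 d10 hd1] := intop_equicontinuous mI h0 mk mh ikh ck s01 e20.
(* The contribution of [v] is at most [(S * |W| + 1) * e'], which is [e / 2]; the added 1 keeps the
   denominator positive. *)
pose e' := e / 2 / (S * `|W| + 1).
have e'0 : 0 < e' by rewrite divr_gt0// ltr_wpDl// mulr_ge0.
move: (cv.1) => /subspace_continuousP/(_ s s01)/cvgrPdist_lt/(_ _ e'0)/nbhs_ballP[d2 /= d20 hd2].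
exists (Num.min d1 d2); first by rewrite lt_min d10 d20.
move=> t t01; rewrite lt_min => /andP[td1 td2] x ax.
apply: le_lt_trans (hS _ _ _ (K_CBV ax)) _.
rewrite (splitr e) ler_ltD//; last by apply: hd1 => //; exact: majN.
have vts : `|v t - v s| <= e'.
  rewrite distrC ltW//; apply: hd2 t01.
  by rewrite /ball/= distrC.
apply: (@le_trans _ _ ((S * `|W| + 1) * e')).
  apply: ler_pM => //; first by rewrite mulr_ge0// (le_trans _ (BVnorm_ge (K_CBV ax) s01)).
  rewrite (@le_trans _ _ (S * `|W|))// ?lerDl//.
  by rewrite ler_wpM2l// (le_trans (K_norm ax))// ler_norm.
by rewrite /e' mulrC divfK// gt_eqF// ltr_wpDl// mulr_ge0.
Qed.

(** Brouwer's theorem applies to the map sending the step values [c] to the values of [T (step c)]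
    at the grid points: it is bounded by [C * W], and [T_cvg] makes it continuous. *)
Let galerkin n : exists2 x, admissible x &
  forall s, x s = T x (grid_point n (grid_idx n s)).
Proof.
have [C C0 hC] := lift_bound ad bd cv ab.
pose step (c : 'I_n.+1 -> R) (s : R) := c (grid_idx n s).
have astep c : admissible (step c) by exact: (@measurable_step R F n c mF).
have [u x uc j|c Tc] := @brouwer_bounded R 'I_n.+1
    (fun c i => T (step c) (grid_point n i)) (C * W)
    (fun c i => T_bound hC C0 (astep c) (grid_point01 n i)).
  have [_] := @T_cvg (step \o u) (step x) (fun n => astep _) (fun s _ => uc _).
  by apply; exact: grid_point01.
exists (step c) => // s.
by rewrite [LHS]/step -[in LHS]Tc.
Qed.

(** The bound on the solution is part of the conclusion because it later removes the truncation; [C]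
    is an argument so that the truncation level can be chosen from it beforehand. *)
Theorem hammerstein C : 0 <= C ->
  (forall y t, CBV y -> t \in `[0, 1] -> `|lift alpha beta v y t| <= C * BVnorm y) ->
  exists2 x, CBV x & forall t, t \in `[0, 1] -> `|x t| <= C * W /\
  x t = alpha x * v t + beta x * w t + \int[leb]_(s in I01) (k t s * F s (x s)).
Proof.
move=> C0 hC.
have /choice[x_ hx] : forall n, exists x, admissible x /\
    forall s, x s = T x (grid_point n (grid_idx n s)).
  by move=> n; have [x ax xT] := galerkin n; exists x.
have ax n := (hx n).1; have xT n := (hx n).2.
(* Convergence is arranged at the points of all grids, a countable dense subset of [0,1]. *)
have [sigma sn [l ul]] := @bounded_subsequence R (nat * nat)%type
  (fun n p => T (x_ n) (grid_point p.1 p.2)) (C * W)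
  (fun n p => T_bound hC C0 (ax n) (grid_point01 p.1 p.2)).
(* Equicontinuity compares [s] with a nearby grid point [p]; the limit at [p] is the centre for the
   Cauchy condition. *)
have cvgT s : s \in `[0, 1] -> cvg (T (x_ (sigma n)) s @[n --> \oo]).
  move=> s01; apply/cauchy_cvgP; apply: cauchy_exP => e e0.
  have e20 : 0 < e / 2 by rewrite divr_gt0.
  have [delta d0 hd] := T_equicontinuous s01 e20.
  have [N0 hN0] : exists N0, (N0.+1%:R^-1 : R) < delta.
    have [N0 _ /(_ N0 (leqnn _))] := near_infty_natSinv_lt (PosNum d0).
    by exists N0.
  pose p := grid_point N0 (grid_idx N0 s) : R.
  have ps : `|p - s| < delta by apply: le_lt_trans hN0; exact: grid_point_close.
  exists (l (N0, grid_idx N0 s : nat)).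
  have /cvgrPdist_lt/(_ _ e20) := ul (N0, grid_idx N0 s : nat).
  apply: filterS => n; rewrite /ball/= -/p => lp.
  have := hd p (grid_point01 _ _) ps _ (ax (sigma n)) => ps'.
  rewrite (splitr e) -(subrK (T (x_ (sigma n)) p) (l _)) -addrA.
  by rewrite (le_lt_trans (ler_normD _ _))// ltrD.
pose y s := limn (fun n => T (x_ (sigma n)) s).
have Ty s : s \in `[0, 1] -> T (x_ (sigma n)) s @[n --> \oo] --> y s.
  by move=> s01; exact: cvgT.
(* By [xT], the step function takes at [s] the value of its image at a grid point within [1/(n+1)]
   of [s], so equicontinuity gives it the limit of [Ty]. *)
have xy s : s \in `[0, 1] -> x_ (sigma n) s @[n --> \oo] --> y s.
  move=> s01; apply/cvgrPdist_lt => e e0.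
  have e20 : 0 < e / 2 by rewrite divr_gt0.
  have [delta d0 hd] := T_equicontinuous s01 e20.
  move/cvgrPdist_lt : (Ty _ s01) => /(_ _ e20).
  move=> /(filterI (near_infty_natSinv_lt (PosNum d0))); apply: filterS => n [nd yT].
  rewrite (splitr e) -(subrK (T (x_ (sigma n)) s) (y s)) -addrA.
  rewrite (le_lt_trans (ler_normD _ _))// ltrD// distrC xT.
  apply: hd => //; first exact: grid_point01.
  apply: le_lt_trans nd; apply: le_trans (grid_point_close _ s01) _.
  by rewrite lef_pV2 ?posrE// ler_nat ltnS.
have [ay Tcvg] := T_cvg (fun n => ax (sigma n)) xy.
have yE s : s \in `[0, 1] -> y s = T y s.
  by move=> s01; apply: (cvg_unique _ (Ty _ s01) (Tcvg _ s01)).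
(* The witness is [T y], a value of [lift], so that [liftP] applies; it agrees with [y] on [0,1],
   which is all that the integral sees. *)
exists (T y); first by apply: CBV_lift => //; exact: K_CBV.
move=> t t01; split; first exact: T_bound.
rewrite {1}/T (liftP ad bd cv alpha1 beta1 ab vw (K_CBV ay) t01).
congr (_ + _); rewrite /K /intop t01; apply: eq_Rintegral => s /set_mem s01.
by rewrite /N -yE.
Qed.
End hammerstein.

(** * Sublinear nonlinearities *)

Lemma integrable_Lp01 {R : realType} (p : R) (g : R -> R) : in_Lp01 p%:E g ->
  (@leb R).-integrable I01 (EFin \o (fun s => `|g s| `^ p)).
Proof.
move=> [mg ig]; apply/integrableP; split.
  apply/measurable_EFinP; apply: (measurableT_comp (measurable_powR p)).
  exact: measurableT_comp.
rewrite (_ : (fun x => _) = (fun x => (`|g x| `^ p)%:E))//.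
by apply/funext => x /=; rewrite ger0_norm// powR_ge0.
Qed.

(** For finite [p] Young's inequality bounds the product by a sum of powers; for [p = +oo] the
    essential bound of [f] and [q = 1] are used. *)
Lemma integrable_Lp01M (R : realType) (p : \bar R) (q : R) (f g : R -> R) :
  (1 < p)%E -> 1 <= q ->
  ((p = +oo%E /\ q = 1) \/ (exists r : R, p = r%:E /\ r^-1 + q^-1 = 1)) ->
  in_Lp01 p f -> in_Lp01 q%:E g -> (@leb R).-integrable I01 (EFin \o (g \* f)).
Proof.
move=> p1 q1 pq Lf Lg.
have mgf : measurable_fun I01 (g \* f : LebR -> R).
  by apply: measurable_funM; [exact: Lg.1|case: p Lf {p1 pq} => [?||] []].
have igq := integrable_Lp01 Lg.
case: pq => [[pE qE]|[r [pE rq]]]; subst p.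
  have [mf [M fM]] := Lf; apply/integrableP; split; first exact/measurable_EFinP.
  have iMg := integrableZl (@measurable_I01 R) `|M| igq.
  apply: le_lt_trans (integrable_lty (@measurable_I01 R) iMg).
  apply: ae_ge0_le_integral.
  - exact: measurable_I01.
  - by move=> s _; exact: abse_ge0.
  - by apply: measurableT_comp => //; exact/measurable_EFinP.
  - by move=> s _; rewrite mule_ge0// lee_fin powR_ge0.
  - by case/integrableP : iMg.
  apply: filterS fM => s + Ds => /(_ Ds) fsM.
  rewrite /= qE powRr1// lee_fin normrM mulrC ler_wpM2r//.
  by rewrite (le_trans fsM)// ler_norm.
have q0 : 0 < q by rewrite (lt_le_trans _ q1).
have r0 : 0 < r by move: p1; rewrite lte_fin; exact: lt_trans.
have ifr := integrable_Lp01 Lf.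
have iqr := integrableD (@measurable_I01 R)
  (integrableZl (@measurable_I01 R) q^-1 igq) (integrableZl (@measurable_I01 R) r^-1 ifr).
apply: le_integrable iqr => //; first exact: measurable_I01.
  exact/measurable_EFinP.
move=> s Ds; rewrite /= lee_fin.
rewrite normrM; apply: le_trans (ler_norm _).
rewrite ![_^-1 * _]mulrC; apply: conjugate_powR => //.
by rewrite addrC.
Qed.

Lemma cvg_integral_scale d (T : measurableType d) (R : realType)
    (mu : {measure set T -> \bar R}) (D : set T) (k : R -> T -> R) (phi : T -> R)
    (A : set R) (c tau : R) :
  measurable D -> (forall t, A t -> measurable_fun D (k t)) ->
  measurable_fun D phi -> (forall s, D s -> 0 <= phi s) -> 0 <= c -> A tau ->
  (fun t => \int[mu]_(s in D) (`|k t s - k tau s| * phi s)%:E)%E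
    @ within A (nbhs tau) --> 0%E ->
  (fun t => \int[mu]_(s in D) (`|k t s - k tau s| * (c * phi s))%:E)%E
    @ within A (nbhs tau) --> 0%E.
Proof.
move=> mD mk mphi phi0 c0 Atau /(cvgeZl (y := c%:E) isT); rewrite mule0.
apply: cvg_trans; apply: near_eq_cvg; apply/nbhs_ballP; exists 1 => //= t _ At.
rewrite -ge0_integralZl_EFin//.
- by apply: eq_integral => s _; rewrite -EFinM mulrCA.
- by move=> s Ds; rewrite lee_fin mulr_ge0 ?phi0.
- apply/measurable_EFinP; apply: measurable_funM => //.
  by apply: measurableT_comp => //; apply: measurable_funB; exact: mk.
Qed.

(** Far out, [psi r / r] lies below [1 / (|A| + 1)], a positive number whatever [A] is. *)
Lemma sublinear_small (R : realType) (psi : R -> R) (A : R) :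
  (forall r, 0 <= r -> 0 <= psi r) -> psi r / r @[r --> +oo] --> 0 ->
  exists2 r, 0 < r & A * psi r <= r.
Proof.
move=> psi0 psir; have e0 : 0 < (`|A| + 1)^-1 by rewrite invr_gt0 ltr_wpDl.
have /cvgrPdist_lt/(_ _ e0)/(filterI (nbhs_pinfty_gt (num_real 0)))/filter_ex[r [/= r0]] := psir.
have pr0 := psi0 _ (ltW r0).
rewrite sub0r normrN ger0_norm ?divr_ge0// 1?ltW// ltr_pdivrMr// => pr.
exists r => //; apply: (@le_trans _ _ ((`|A| + 1) * psi r)).
  by rewrite ler_wpM2r// (le_trans (ler_norm A))// lerDl.
by rewrite -ler_pdivlMl ?ltW// ltr_wpDl.
Qed.

Theorem theorem4p6 (R : realType)
  (alpha beta : (R -> R) -> R) (v w : R -> R)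
  (p : \bar R) (q : R)
  (f : R -> R -> R) (psi phi : R -> R)
  (k : R -> R -> R) (m : R -> R) :
  CBVdual alpha -> CBVdual beta -> CBV v -> CBV w ->
  alpha (fun _ => 1) = 0 -> beta (fun _ => 1) = 0 ->
  `|alpha v - beta v| < 1 ->
  (forall t, t \in `[0, 1] -> v t + w t = 1) ->
  (1 < p)%E -> 1 <= q ->
  ((p = +oo%E /\ q = 1) \/ (exists r : R, p = r%:E /\ r^-1 + q^-1 = 1)) ->
  (* hypotheses on f *)
  (forall u, leb_meas01 (fun t => f t u)) ->
  {ae leb, forall t : LebR, I01 t -> continuous (f t)} ->
  (forall r, 0 <= r -> 0 <= psi r) ->
  {in `[0, +oo[ &, {homo psi : r s / r <= s}} ->
  in_Lp01 p phi -> (forall t, t \in `[0, 1] -> 0 <= phi t) ->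
  (forall t u, t \in `[0, 1] -> `|f t u| <= phi t * psi `|u|) ->
  psi r / r @[r --> +oo] --> 0 ->
  (* hypotheses on k *)
  (forall t, t \in `[0, 1] -> in_Lp01 q%:E (fun s => k t s)) ->
  in_Lp01 q%:E m -> (forall s, s \in `[0, 1] -> 0 <= m s) ->
  {ae leb, forall s : LebR, I01 s ->
     (total_variation 0 1 (fun t => k t s) <= (m s)%:E)%E} ->
  (forall tau, tau \in `[0, 1] ->
     (fun t => \int[leb]_(s in I01) (`|k t s - k tau s| * phi s)%:E)%E
       @ within `[0, 1]%classic (nbhs tau) --> 0%E) ->
  exists x : R -> R, CBV x /\
    forall t, t \in `[0, 1] ->
      x t = alpha x * v t + beta x * w t
            + fine (\int[leb]_(s in I01) (k t s * f s (x s))%:E)%E.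
Proof.
move=> ad bd cv _ alpha1 beta1 ab vw p1 q1 pq mf cf psi0 psimono Lphi phi0 fphi psir
  Lk Lm m0 tvk ck.
have mphi : leb_meas01 phi by case: p Lphi {p1 pq} => [?||] [].
have ikphi t : t \in `[0, 1] -> leb.-integrable I01 (EFin \o (k t \* phi)).
  by move=> t01; exact: integrable_Lp01M p1 q1 pq Lphi (Lk _ t01).
have imphi : leb.-integrable I01 (EFin \o (m \* phi)).
  exact: integrable_Lp01M p1 q1 pq Lphi Lm.
have mI := @measurable_I01 R.
have [C C0 hC] := lift_bound ad bd cv ab.
pose W := \int[leb]_(s in I01) (intop_weight (k : R -> LebR -> R) m s * phi s).
(* [C * W * psi r] will bound the solution of the problem truncated at level [r], so that this
   solution stays in [[-r, r]]. *)
have [r r0 small] := sublinear_small (C * W) psi0 psir.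
pose clamp (u : R) := Num.max (- r) (Num.min u r).
have clamp_le u : `|clamp u| <= r.
  rewrite ler_norml /clamp le_max lexx/= ge_max ge_min lexx orbT andbT.
  by rewrite (le_trans _ (ltW r0))// oppr_le0 ltW.
have clamp_id u : `|u| <= r -> clamp u = u.
  rewrite ler_norml /clamp => /andP[ru ur].
  by rewrite (min_idPl ur) (max_idPr ru).
have clamp_cont : continuous clamp.
  move=> u; apply: (@continuous_max _ _ (fun=> - r) (fun u => Num.min u r)).
    exact: cvg_cst.
  by apply: (@continuous_min _ _ id (fun=> r)); [exact: cvg_id|exact: cvg_cst].
pose h s := psi r * phi s.
have h_int (g : LebR -> R) : leb.-integrable I01 (EFin \o (g \* phi)) ->
    leb.-integrable I01 (EFin \o (g \* (h : LebR -> R))).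
  move=> ig; apply: eq_integrable (integrableZl mI (psi r) ig) => // s _ /=.
  by rewrite -EFinM mulrCA.
have pr0 : 0 <= psi r by apply: psi0; exact: ltW.
have h0 (s : LebR) : I01 s -> 0 <= h s by move=> s01; rewrite mulr_ge0 ?phi0.
have mkt (t : R) : t \in `[0, 1] -> measurable_fun I01 (k t : LebR -> R).
  by move=> t01; exact: (Lk _ t01).1.
have ckh (tau : R) : tau \in `[0, 1] ->
    (fun t => \int[leb]_(s in I01) (`|k t s - k tau s| * h s)%:E)%E
      @ within `[0, 1]%classic (nbhs tau) --> 0%E.
  move=> tau01.
  exact: (cvg_integral_scale mI mkt mphi phi0 pr0 tau01 (ck _ tau01)).
have mh : leb_meas01 h by apply: measurable_funM => //; exact: measurable_cst.
have cF : {ae leb, forall s : LebR, I01 s -> continuous (fun u => f s (clamp u))}.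
  apply: filterS cf => s + Ds => /(_ Ds) cfs u.
  by apply: (@continuous_comp _ _ _ clamp (f s)); [exact: clamp_cont|exact: cfs].
have Fh s u : s \in `[0, 1] -> `|f s (clamp u)| <= h s.
  move=> s01; rewrite /h mulrC (le_trans (fphi _ _ s01))// ler_wpM2l ?phi0//.
  by apply: psimono; rewrite ?in_itv/= ?andbT// ltW.
have [x cx hx] := hammerstein ad bd cv alpha1 beta1 ab vw h0 m0 mkt Lm.1 mh
  (fun t t01 => h_int _ (ikphi t t01)) (h_int _ imphi) tvk ckh
  (fun u => mf (clamp u)) cF Fh C0 hC.
have WE : \int[leb]_(s in I01) (intop_weight (k : R -> LebR -> R) m s * h s) = psi r * W.
  have in0 : (0 : R) \in `[0, 1] by rewrite in_itv/= lexx ler01.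
  rewrite -RintegralZl//; first by apply: eq_Rintegral => s _; rewrite mulrCA.
  have mphi1 : majorized I01 (phi : LebR -> R) 1 phi.
    by split => // s Ds; rewrite mul1r ger0_norm// phi0.
  have := integrable_weightM mI phi0 m0 mkt Lm.1 ikphi imphi mphi1.
  by apply: eq_integrable => // s /set_mem Ds; rewrite /= ger0_norm// phi0.
exists x; split => // t t01; have [_ ->] := hx t t01.
(* By the choice of [r], [clamp] is the identity along the solution, so the truncated equation is
   the original one. *)
congr (_ + _); apply: eq_Rintegral => s /set_mem s01.
rewrite clamp_id//; have [xs _] := hx s s01.
by rewrite (le_trans xs)// WE (mulrC (psi r)) mulrA.
Qed.
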